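(* Let $\mathcal{A}$ be a finite set with a statistic $D:\mathcal{A}\to 2^{[N-1]}$, and let $n = \lfloor N/2\rfloor$. The following are equivalent: (i) $D$ is sparse, and for every sparse $J\subseteq[N-1]$ the cardinality of $\{a\in\mathcal{A} \mid D(a)\supseteq J\}$ depends only on $|J|$; (ii) $\mathcal{A}$ is symmetric with respect to $D$ and $\mathcal{Q}_{N,D}(\mathcal{A}) = \sum_{k=0}^{n} c_k s_{(N-k,k)}$ for some $c_k\in\mathbb{Z}$. Furthermore, if these hold, then $\mathcal{A}$ is Schur-positive and \[ \mathcal{Q}_{N,D}(\mathcal{A}) = \sum_{k=0}^{n} \bigl|\{a\in\mathcal{A} \mid D(a) = \{1,3,5,\dots,2k-1\}\}\bigr|\, s_{(N-k,k)}. \]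
   Context: For $N \ge 1$ and $J \subseteq [N-1]$, $F_{N,J} = \sum x_{i_1}\cdots x_{i_N}$, summed over $i_1 \le \dots \le i_N$ with $i_j < i_{j+1}$ for all $j \in J$ (fundamental quasisymmetric function). For a finite set $\mathcal{A}$ and $D:\mathcal{A}\to 2^{[N-1]}$, $\mathcal{Q}_{N,D}(\mathcal{A}) = \sum_{a\in\mathcal{A}} F_{N,D(a)}$. $\mathcal{A}$ is symmetric w.r.t. $D$ if this is a symmetric function, and then it expands uniquely as $\sum_{\lambda\vdash N}c_\lambda s_\lambda$ in Schur functions; $\mathcal{A}$ is Schur-positive if all $c_\lambda\in\mathbb{N}_0$. A set $J\subseteq[N-1]$ is sparse if $\{j,j+1\}\not\subseteq J$ for every $1\le j\le N-2$; $D$ is sparse if $D(a)$ is sparse for every $a\in\mathcal{A}$. For $k=0$ the set $\{1,3,\dots,2k-1\}$ is empty. *)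

(* Defs.v *)
(* MathComp, with finmap multisets and the classical sets and finitely
   supported sums of mathcomp.classical. *)
From HB Require Import structures.
From mathcomp Require Import all_boot all_order all_algebra.
From mathcomp Require Import finmap multiset.
From mathcomp Require Import mathcomp_extra boolp classical_sets functions.
From mathcomp Require Import cardinality fsbigop.
Set Implicit Arguments.
Unset Strict Implicit.
Unset Printing Implicit Defensive.
Import GRing.Theory Num.Theory.

Local Open Scope mset_scope.
Local Open Scope classical_set_scope.
Local Open Scope ring_scope.

(* The variables are x_0, x_1, x_2, ...; a monomial is the multiset of the
   indices of its variables (m i is the exponent of x_i), and a formal power
   series over the integers is its family of coefficients.  Series are added
   pointwise, by the zmodType structure of functions in mathcomp.classical. *)
Definition series := {mset nat} -> int.

(* The possibly infinite sum of x_{w_1} ... x_{w_l}, over t in S, where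
   w_1, ..., w_l is the word of t.  The coefficient of m is the number of t in S
   whose word has content m; in all the uses below this number is finite (for
   an infinite set of such t, the sum would be 0 by convention). *)
Definition gen_series (T : choiceType) (S : set T) (word : T -> seq nat) :
    series :=
  fun m => \sum_(t \in S) ((seq_mset (word t) == m)%:R : int).

(* Subsets of [N-1] = {1, ..., N-1} are represented by {set 'I_N.-1}, where
   j : 'I_N.-1 stands for the element j.+1 of [N-1]. *)

(* As the word w is indexed from 0, w_j < w_{j+1} for j.+1 reads as follows. *)
Definition fqs_word (N : nat) (J : {set 'I_N.-1}) (w : N.-tuple nat) : Prop :=
  sorted leq w /\ (forall j, j \in J -> (nth 0%N w j < nth 0%N w j.+1)%N).

Definition fundamental_qs (N : nat) (J : {set 'I_N.-1}) : series :=
  gen_series [set w : N.-tuple nat | fqs_word J w] (fun w => w).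

Definition Qseries (N : nat) (A : finType) (D : A -> {set 'I_N.-1}) : series :=
  \sum_(a : A) fundamental_qs (D a).

Definition sparse (N : nat) (J : {set 'I_N.-1}) : bool :=
  [forall i : 'I_N.-1, forall j : 'I_N.-1,
     (j == i.+1 :> nat) ==> ~~ ((i \in J) && (j \in J))].

(* The set {1, 3, 5, ..., 2k-1}. *)
Definition odds (N k : nat) : {set 'I_N.-1} :=
  [set j : 'I_N.-1 | odd j.+1 && (j.+1 < k.*2)%N].

(* A power series of bounded degree which is invariant under the permutations
   of the variables: m' below is the image of m under x_i |-> x_{s i}. *)
Definition symmetric_function (f : series) : Prop :=
  (exists d : nat, forall m : {mset nat}, (d < size m)%N -> f m = 0) /\
  (forall (s : nat -> nat) (m m' : {mset nat}),
     bijective s -> (forall i, m' (s i) = m i) -> f m' = f m).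

Definition is_partition (N : nat) (la : seq nat) : bool :=
  [&& sorted geq la, 0%N \notin la & sumn la == N].

(* Semistandard Young tableaux, given by the sequence of their rows. *)
Definition ssyt (la : seq nat) (t : seq (seq nat)) : Prop :=
  [/\ shape t = la, all (sorted leq) t &
      forall r c, (c < nth 0%N la r.+1)%N ->
        (nth 0%N (nth [::] t r) c < nth 0%N (nth [::] t r.+1) c)%N].

Definition schur (la : seq nat) : series :=
  gen_series [set t : seq (seq nat) | ssyt la t] flatten.

(* The partition (N-k, k), without its zero parts. *)
Definition two_row (N k : nat) : seq nat :=
  [seq p <- [:: (N - k)%N; k] | (0 < p)%N].

(* The coefficients of an expansion into Schur functions are unique, so that
   an expansion with coefficients in nat is the expansion with nonnegative
   coefficients. *)
Definition schur_positive (N : nat) (f : series) : Prop :=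
  symmetric_function f /\
  exists c : seq nat -> nat,
    f = \sum_(la \in [set la | is_partition N la]) schur la *+ c la.

(* Main.v *)
(* Let [w] be the weakly increasing word of a monomial [m] of degree [N], with
   set of strict ascents [S].  The coefficient of [m] in [F_J] is 1 if [J] is
   contained in [S] and 0 otherwise.  A semistandard tableau of shape (N-k, k) and
   content [m] records, for each letter of [w], the row which contains it; this
   gives a bijection with the ballot words with [k] letters in the second row and
   descents in [S], so that s_(N-k,k) is the sum of the [F_(Des b)] over all ballot
   words [b] with [k] letters in the second row.  These descent sets are sparse, a
   sparse [J] lies in a number of them which depends only on |J| (delete the
   prescribed descents), and {1, 3, ..., 2k-1} is the descent set of exactly one
   ballot word.

   Given (i), the difference of the two sides of the asserted expansion is a
   combination of the [F_J] with coefficients supported on sparse sets, zero at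
   every {1, 3, ..., 2k-1}, and whose sums over supersets of a sparse [J] depend
   only on |J|; descending induction on |J| shows that they vanish.  Conversely,
   the coefficients on the [F_J] are determined by the series, and (i) holds for
   ballot words.

   For the symmetry, inclusion-exclusion writes the coefficient of [m] in terms of
   the numbers of sparse sets of each size avoiding [S], whose generating
   polynomial is a product over the runs of equal letters of [w]. *)
Require Import Defs.
From HB Require Import structures.
From mathcomp Require Import all_boot all_order all_algebra.
From mathcomp Require Import finmap multiset.
From mathcomp Require Import mathcomp_extra boolp classical_sets functions.
From mathcomp Require Import cardinality fsbigop.
From mathcomp Require Import zify.
(* Gives precedence to the lemmas on finite sets over those on classical sets. *)
From mathcomp Require Import fintype finset.
Import GRing.Theory Num.Theory.
Set Implicit Arguments.
Unset Strict Implicit.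
Unset Printing Implicit Defensive.

Local Open Scope mset_scope.
Local Open Scope nat_scope.

(** * Two-row tableaux and ballot words *)

(** [false] puts a letter in the first row and [true] in the second; [h] is the current excess of
    the first row over the second. *)
Fixpoint ballot (h : nat) (b : seq bool) : bool :=
  match b with
  | [::] => true
  | false :: b' => ballot h.+1 b'
  | true :: b' => (0 < h) && ballot h.-1 b'
  end.

Definition descent (b : seq bool) (i : nat) : bool :=
  ~~ nth false b i && nth false b i.+1.

Lemma descent_size (b : seq bool) (i : nat) : descent b i -> i.+1 < size b.
Proof.
by rewrite /descent => /andP[_]; case: (ltnP i.+1 (size b)) => // h; rewrite nth_default.
Qed.

(** For weakly increasing [w] of the same length, this puts [true] before [false] within each run of
    equal letters. *)
Definition compat (b : seq bool) (w : seq nat) : Prop :=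
  forall i, descent b i -> nth 0 w i < nth 0 w i.+1.

Lemma compat_cons (x : bool) (b : seq bool) (v : nat) (w : seq nat) :
  compat (x :: b) (v :: w) -> compat b w.
Proof. by move=> c i; apply: (c i.+1). Qed.

Lemma compat_cons_true (b : seq bool) (v : nat) (w : seq nat) :
  compat b w -> compat (true :: b) (v :: w).
Proof. by move=> c [|i] // /c. Qed.

Lemma sorted_cons_all (v : nat) (w : seq nat) :
  sorted leq (v :: w) -> forall x, x \in w -> v <= x.
Proof. by rewrite /= path_sortedE => [/andP[/allP]|]//; exact: leq_trans. Qed.

Lemma sorted_behead (v : nat) (w : seq nat) : sorted leq (v :: w) -> sorted leq w.
Proof. exact: path_sorted. Qed.

(** Equal letters are contiguous, and within their run a second-row letter cannot follow a first-row
    one. *)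
Lemma compat_false_notin (b : seq bool) (v : nat) (w : seq nat) :
  size b = size w -> sorted leq (v :: w) -> compat (false :: b) (v :: w) ->
  v \notin mask b w.
Proof.
elim: w v b => [|u w IH] v b; first by rewrite mask0.
case: b => [|x b] //= [sz] /andP[vu uw] c.
case: x c => c /=.
  have lt : v < u by apply: (c 0).
  rewrite inE negb_or neq_ltn lt /=; apply/negP => /mem_mask.
  by move/(sorted_cons_all uw); rewrite leqNgt lt.
have [e|ne] := eqVneq v u.
  by rewrite e; apply: IH => //; apply: compat_cons c.
apply/negP => /mem_mask /(sorted_cons_all uw); lia.
Qed.

Lemma compat_cons_false (b : seq bool) (v : nat) (w : seq nat) :
  size b = size w -> sorted leq (v :: w) -> compat b w ->
  v \notin mask b w -> compat (false :: b) (v :: w).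
Proof.
case: w b => [|u w] [|x b] //=; first by move=> _ _ _ _ i /descent_size.
move=> [sz] /andP[vu uw] c nin [|i] //.
  by case: x nin {c} => //=; rewrite inE negb_or => /andP[ne _] _; lia.
by move=> h; apply: c.
Qed.

Definition column_strict (q r : seq nat) : Prop :=
  forall c, c < size r -> nth 0 q c < nth 0 r c.

Lemma column_strict_cons (x y : nat) (q r : seq nat) :
  column_strict (x :: q) (y :: r) <-> x < y /\ column_strict q r.
Proof.
split=> [h|[xy h] [|c] //]; last exact: h.
by split=> [|c hc]; [apply: (h 0) | apply: (h c.+1)].
Qed.

(* [q] holds the entries of the first row which have no entry below them yet. *)
Lemma ballot_column_strict (b : seq bool) (w q : seq nat) :
  size b = size w -> sorted leq w -> compat b w ->
  (forall x y, x \in q -> y \in mask b w -> x < y) ->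
  size (mask b w) <= size (q ++ mask (map negb b) w) ->
  ballot (size q) b <-> column_strict (q ++ mask (map negb b) w) (mask b w).
Proof.
elim: w b q => [|v w IH] [|x b] q //= [sz] srt c hq hsz.
have sw := sorted_behead srt; have cw := compat_cons c.
case: x c hq hsz => /= c hq hsz; last first.
  (* The letter joins the waiting entries; by compatibility all later second-row entries exceed
     it. *)
  rewrite -cat_rcons -(size_rcons q v); apply: IH => //; last by rewrite cat_rcons.
  move=> x y; rewrite mem_rcons inE => /orP[/eqP->|xq] yb; last exact: hq.
  have := compat_false_notin sz srt c.
  have := sorted_cons_all srt (mem_mask yb).
  rewrite leq_eqVlt => /orP[/eqP->|//]; by rewrite yb.
(* A second-row letter goes below the oldest waiting entry. If none is waiting, the entry above it
   comes later in [w], hence is not smaller. *)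
case: q hq hsz => [|x q] hq hsz /=.
  split=> //; move: hsz => /=; case E : (mask (map negb b) w) => [|y r] //= _.
  move=> /(proj1 (column_strict_cons _ _ _ _)) [+ _].
  have /mem_mask /(sorted_cons_all srt) : y \in mask [seq ~~ i | i <- b] w by rewrite E inE eqxx.
  lia.
have hq' y z : y \in q -> z \in mask b w -> y < z.
  by move=> yq zb; apply: hq; rewrite inE ?yq ?zb orbT.
rewrite (IH b q sz sw cw hq' hsz) column_strict_cons; split=> [h|[] //]; split=> //.
by apply: hq; rewrite inE eqxx.
Qed.

Lemma perm_cat_cons (v : nat) (r1 r2 w : seq nat) :
  perm_eq (r1 ++ v :: r2) (v :: w) = perm_eq (r1 ++ r2) w.
Proof. by rewrite -[v :: r2]cat1s perm_catCA /= perm_cons. Qed.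

Lemma perm_mask_negb (b : seq bool) (w : seq nat) :
  size b = size w -> perm_eq (mask (map negb b) w ++ mask b w) w.
Proof.
elim: w b => [|v w IH] [|[] b] //= [sz]; last by rewrite perm_cons IH.
by rewrite perm_cat_cons IH.
Qed.

(** At the first disagreement, the same letter would head the remaining second row of one word and
    be absent from that of the other. *)
Lemma mask_inj (b b' : seq bool) (w : seq nat) :
  size b = size w -> size b' = size w -> sorted leq w ->
  compat b w -> compat b' w -> mask b w = mask b' w ->
  mask (map negb b) w = mask (map negb b') w -> b = b'.
Proof.
elim: w b b' => [|v w IH] [|x b] [|x' b'] //= [sz] [sz'] srt c c'.
have sw := sorted_behead srt; have cw := compat_cons c; have cw' := compat_cons c'.
case: x x' c c' => [] [] c c' /=.
- by case=> e e'; rewrite (IH b b').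
- by move=> e _; have := compat_false_notin sz' srt c'; rewrite -e inE eqxx.
- by move=> e _; have := compat_false_notin sz srt c; rewrite e inE eqxx.
- by move=> e [] e'; rewrite (IH b b').
Qed.

Lemma sorted_head_perm (v : nat) (w r : seq nat) :
  sorted leq (v :: w) -> sorted leq r -> {subset r <= v :: w} -> v \in r ->
  exists r', r = v :: r'.
Proof.
case: r => [|u r] // srt srt' sub vr; exists r; congr (_ :: _).
apply/eqP; rewrite eqn_leq; apply/andP; split.
  by move: vr; rewrite inE => /orP[/eqP->//|/(sorted_cons_all srt')].
have := sub u; rewrite !inE eqxx /= => /(_ isT) /orP[/eqP->//|].
exact: sorted_cons_all.
Qed.

(* Among equal entries, those of the second row come first. *)
Lemma exists_mask (w r1 r2 : seq nat) :
  sorted leq w -> sorted leq r1 -> sorted leq r2 -> perm_eq (r1 ++ r2) w ->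
  exists b, [/\ size b = size w, mask b w = r2, mask (map negb b) w = r1 & compat b w].
Proof.
elim: w r1 r2 => [|v w IH] r1 r2 srt s1 s2 p.
  move: (perm_size p); rewrite size_cat.
  case: r1 r2 {s1 s2 p} => [|? ?] [|? ?] // _; exists [::]; split=> // i.
  by rewrite /descent !nth_nil.
have sw := sorted_behead srt.
have sub1 : {subset r1 <= v :: w} by move=> x xr; rewrite -(perm_mem p) mem_cat xr.
have sub2 : {subset r2 <= v :: w} by move=> x xr; rewrite -(perm_mem p) mem_cat xr orbT.
have [vr2|vr2] := boolP (v \in r2).
  have [r2' e] := sorted_head_perm srt s2 sub2 vr2; subst r2.
  have p' : perm_eq (r1 ++ r2') w.
    by rewrite -(perm_cat_cons v).
  have [b [sb e1 e2 cb]] := IH _ _ sw s1 (sorted_behead s2) p'.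
  by exists (true :: b); split; rewrite /= ?sb ?e1 ?e2 //; exact: compat_cons_true.
have vr1 : v \in r1.
  by have := perm_mem p v; rewrite mem_cat (negbTE vr2) orbF inE eqxx.
have [r1' e] := sorted_head_perm srt s1 sub1 vr1; subst r1.
have p' : perm_eq (r1' ++ r2) w by move: p; rewrite cat_cons perm_cons.
have [b [sb e1 e2 cb]] := IH _ _ sw (sorted_behead s1) s2 p'.
exists (false :: b); split; rewrite /= ?sb ?e1 ?e2 //.
by apply: compat_cons_false => //; rewrite e1.
Qed.

Lemma sum_tupleS (V : nmodType) (n : nat) (F : seq bool -> V) :
  (\sum_(t : n.+1.-tuple bool) F t =
   \sum_(t : n.-tuple bool) F (false :: t) + \sum_(t : n.-tuple bool) F (true :: t))%R.
Proof.
rewrite (reindex (fun p : bool * n.-tuple bool => cons_tuple p.1 p.2)) /=; last first.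
  exists (fun t => (thead t, behead_tuple t)) => [[b t]|t] _.
    by congr pair; apply: val_inj.
  by rewrite [in RHS](tuple_eta t); apply: val_inj.
by rewrite -(pair_bigA _ (fun b (t : n.-tuple bool) => F (b :: t))) big_bool addrC.
Qed.

(** * Ballot words with prescribed descents *)

Definition covers (e b : seq bool) : bool :=
  `[< forall i, nth false e i -> descent b i >].

Lemma covers_cons_false (x : bool) (e b : seq bool) :
  ~~ head false e -> covers e (x :: b) = covers (behead e) b.
Proof.
move=> he; apply: asbool_equiv_eq; split=> h i.
  by rewrite nth_behead => /h.
case: i => [|i]; first by rewrite nth0 (negbTE he).
by rewrite -nth_behead => /h.
Qed.

Lemma covers_cons_true (x : bool) (e b : seq bool) :
  covers (true :: e) (x :: b) = [&& ~~ x, head false b & covers e b].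
Proof.
rewrite andbA -nth0; apply/asboolP/andP => [h|[xb /asboolP h] [|i] //= /h //].
by split; [apply: (h 0) | apply/asboolP => i /(h i.+1)].
Qed.

(** Counts the completions of a ballot word by [n] letters, starting at height [h] with [c]
    second-row letters already read, and ending with [k] of them. *)
Definition ballot_sum (n h c k : nat) (e : seq bool) : nat :=
  \sum_(t : n.-tuple bool) [&& ballot h t, count id t + c == k & covers e t].

Lemma ballot_sum_false (n h c k : nat) (e : seq bool) : ~~ head false e ->
  ballot_sum n.+1 h c k e =
  ballot_sum n h.+1 c k (behead e) + (0 < h) * ballot_sum n h.-1 c.+1 k (behead e).
Proof.
move=> he; rewrite /ballot_sum.
rewrite (sum_tupleS _ (fun t => nat_of_bool [&& ballot h t, count id t + c == k & covers e t])).
congr (_ + _); last rewrite big_distrr /=; apply: eq_bigr => t _.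
  by rewrite covers_cons_false.
by rewrite covers_cons_false //= addnS; case: (0 < h); rewrite ?mul1n.
Qed.

(** A prescribed descent forces the letters [false], [true], which restore the height and add one
    second-row letter. *)
Lemma ballot_sum_true (n h c k : nat) (e : seq bool) :
  ballot_sum n.+2 h c k [:: true, false & e] = ballot_sum n h c.+1 k e.
Proof.
rewrite /ballot_sum; set e' := [:: _, _ & _].
rewrite (sum_tupleS _ (fun t => nat_of_bool [&& ballot h t, count id t + c == k & covers e' t])).
rewrite [X in (_ + X)%R]big1 => [|t _]; last by rewrite covers_cons_true !andbF.
rewrite GRing.addr0 (sum_tupleS _ (fun t => nat_of_bool
  [&& ballot h (false :: t), count id (false :: t) + c == k & covers e' (false :: t)])).
rewrite [X in (X + _)%R]big1 => [|t _]; last by rewrite covers_cons_true !andbF.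
rewrite GRing.add0r; apply: eq_bigr => t _.
by rewrite covers_cons_true covers_cons_false //= addnS.
Qed.

Definition sparse_mask (e : seq bool) : Prop :=
  forall i, nth false e i -> nth false e i.+1 = false.

(* Deleting the positions of the prescribed descents from a ballot word leaves a
   ballot word, and each such deletion can be undone. *)
Lemma ballot_sumE (n h c k : nat) (e : seq bool) :
  size e = n -> sparse_mask e -> ~~ last false e ->
  (count id e).*2 <= n /\
  ballot_sum n h c k e = ballot_sum (n - (count id e).*2) h (c + count id e) k [::].
Proof.
elim/ltn_ind: n h c e => -[|n] IH h c [|[] e] //= .
- by move=> *; rewrite addn0; split.
- case: n e IH => [|n] [|[] e] //= IH [sz] sp la; first by have := sp 0 isT.
  have spe : sparse_mask e by move=> i; apply: (sp i.+2).
  have lae : ~~ last false e by [].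
  have [le eq] := IH n (ltnW (ltnSn _)) h c.+1 e sz spe lae.
  by rewrite ballot_sum_true eq; split; [lia | congr ballot_sum; lia].
- move=> [sz] sp la; have spe : sparse_mask e by move=> i; apply: (sp i.+1).
  have lae : ~~ last false e by [].
  have [le eq] := IH n (ltnSn _) h.+1 c e sz spe lae.
  have [_ eq'] := IH n (ltnSn _) h.-1 c.+1 e sz spe lae.
  split; first lia.
  (* The bound keeps truncated subtraction exact, so that the right-hand side also unfolds by its
     first letter. *)
  by rewrite ballot_sum_false //= eq eq' add0n subSn // [RHS]ballot_sum_false //= addSn.
Qed.

(** The ballot word whose descents, counted from 1, are 1, 3, ..., 2k-1. *)
Definition odd_word (k m : nat) : seq bool :=
  iter k (fun s => [:: false, true & s]) (nseq m false).

Lemma size_odd_word (k m : nat) : size (odd_word k m) = k.*2 + m.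
Proof. by elim: k => [|k IH] /=; rewrite ?size_nseq // IH doubleS. Qed.

Lemma ballot_odd_word (k m : nat) : ballot 0 (odd_word k m).
Proof. by elim: k => [|k IH] //=; elim: m 0 => [|m IH] h //=. Qed.

Lemma count_odd_word (k m : nat) : count id (odd_word k m) = k.
Proof. by elim: k => [|k /= ->] //=; rewrite count_nseq. Qed.

Lemma descent_odd_word (k m i : nat) :
  descent (odd_word k m) i = ~~ odd i && (i.+1 < k.*2).
Proof.
elim: k i => [|k IH] i; first by rewrite /descent /= !nth_nseq !if_same !andbF.
case: i => [|[|i]] //.
by rewrite /= negbK doubleS !ltnS -IH.
Qed.

Lemma no_descent (b : seq bool) :
  ballot 0 b -> (forall i, descent b i = false) -> b = nseq (size b) false.
Proof.
case: b => [|[] b] //= _; elim: b => [|x b IH] // nd.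
have := nd 0; rewrite /descent /= => x0; subst x; congr (_ :: _).
by apply: IH => i; apply: (nd i.+1).
Qed.

(** The descent at 0 forces the first two letters, after which the height is again 0; once no
    descent is left, only [false] can follow. *)
Lemma odd_wordP (k : nat) (b : seq bool) : ballot 0 b ->
  (forall i, descent b i = ~~ odd i && (i.+1 < k.*2)) ->
  b = odd_word k (size b - k.*2).
Proof.
elim: k b => [|k IH] b hb d.
  by rewrite subn0; apply: no_descent => // i; rewrite d andbF.
have := d 0; rewrite /= doubleS /=; case: b hb d => [|[] [|[] b]] //= hb d _.
congr [:: _, _ & _]; apply: IH => // i.
by have := d i.+2; rewrite /= negbK doubleS !ltnS.
Qed.

(** * Descent sets of ballot words as subsets of [N-1] *)

Section Sets.
Variable N : nat.
Implicit Types (J K : {set 'I_N.-1}) (t : N.-tuple bool).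

Definition descents t : {set 'I_N.-1} := [set j : 'I_N.-1 | descent t j].

Definition ballots (k : nat) : {set N.-tuple bool} :=
  [set t : N.-tuple bool | ballot 0 t && (count id t == k)].

(** Length [N] rather than [N.-1] matches the ballot words; the last letter is always [false]. *)
Definition mask_of J : seq bool := mkseq (mem (map val (enum J))) N.

Lemma nth_mask_of J (i : nat) : nth false (mask_of J) i = (i \in map val (enum J)).
Proof.
have [lt|ge] := ltnP i N; first by rewrite nth_mkseq.
rewrite nth_default ?size_mkseq //; apply/esym/negbTE/negP => /mapP[j _ /= e].
have := ltn_ord j; lia.
Qed.

Lemma mem_mask_of J (j : 'I_N.-1) : (val j \in map val (enum J)) = (j \in J).
Proof. by rewrite (mem_map val_inj) mem_enum. Qed.

Lemma covers_mask_of J t : covers (mask_of J) t = (J \subset descents t).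
Proof.
apply/asboolP/subsetP => h => [j jJ|i]; first by rewrite inE h // nth_mask_of mem_mask_of.
by rewrite nth_mask_of => /mapP[j]; rewrite mem_enum => /h; rewrite inE => d ->.
Qed.

Lemma count_mask_of J : count id (mask_of J) = #|J|.
Proof.
rewrite /mask_of /mkseq count_map -size_filter cardE -(size_map val).
apply/perm_size/uniq_perm; first by rewrite filter_uniq ?iota_uniq.
  by rewrite (map_inj_uniq val_inj) enum_uniq.
move=> i; rewrite mem_filter mem_iota /=; apply: andb_idr => /mapP[j _ ->] /=.
have := ltn_ord j; lia.
Qed.

Lemma sparseP J : reflect (sparse_mask (mask_of J)) (sparse J).
Proof.
apply: (iffP forallP) => h.
  move=> i; rewrite !nth_mask_of => /mapP[j]; rewrite mem_enum => jJ ->.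
  apply/negbTE/negP => /mapP[j']; rewrite mem_enum => jJ' e.
  by have /forallP/(_ j')/implyP := h j; rewrite jJ jJ' => /(_ _)/negP; apply => //; apply/eqP.
move=> j; apply/forallP => j'; apply/implyP => /eqP e; apply/negP => /andP[jJ jJ'].
have := h j; rewrite !nth_mask_of mem_mask_of => /(_ jJ).
by have := mem_mask_of J j'; rewrite /= e jJ' => ->.
Qed.

Lemma last_mask_of J : ~~ last false (mask_of J).
Proof.
rewrite -nth_last size_mkseq nth_mask_of; apply/negP => /mapP[j _ /= e].
by have := ltn_ord j; rewrite -[X in X < _]e ltnn.
Qed.

Lemma card_sparse J : sparse J -> #|J| <= N./2.
Proof.
move/sparseP => sp.
have [+ _] := ballot_sumE 0 0 0 (size_mkseq _ _) sp (last_mask_of J).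
rewrite count_mask_of; lia.
Qed.

Lemma card_ballots_descents J (k : nat) :
  #|[set t in ballots k | J \subset descents t]| = ballot_sum N 0 0 k (mask_of J).
Proof.
rewrite -sum1_card big_mkcond; apply: eq_bigr => t _.
by rewrite !inE addn0 covers_mask_of -andbA; case: ifP.
Qed.

Lemma card_ballots_descents_sparse J J' (k : nat) :
  sparse J -> sparse J' -> #|J| = #|J'| ->
  #|[set t in ballots k | J \subset descents t]| =
  #|[set t in ballots k | J' \subset descents t]|.
Proof.
move=> /sparseP sp /sparseP sp' e; rewrite !card_ballots_descents.
have [_ ->] := ballot_sumE 0 0 k (size_mkseq _ _) sp (last_mask_of J).
have [_ ->] := ballot_sumE 0 0 k (size_mkseq _ _) sp' (last_mask_of J').
by rewrite !count_mask_of e.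
Qed.

Lemma sparse_descents t : sparse (descents t).
Proof.
apply/forallP => j; apply/forallP => j'; apply/implyP => /eqP e.
by rewrite !inE /descent e; case: (nth _ t j.+1); rewrite ?andbF.
Qed.

Lemma sparse_odds (k : nat) : sparse (odds N k).
Proof.
apply/forallP => j; apply/forallP => j'; apply/implyP => /eqP e.
by rewrite !inE e /=; case: (odd j); rewrite ?andbF.
Qed.

Lemma descents_odds t (k : nat) : k <= N./2 ->
  (descents t == odds N k) = [forall i : 'I_N, descent t i == ~~ odd i && (i.+1 < k.*2)].
Proof.
move=> hk; apply/eqP/forallP => [e i|h].
  have [lt|ge] := ltnP i N.-1.
    have /setP/(_ (Ordinal lt)) := e; rewrite !inE /= => ->; by rewrite eqxx.
  (* Position [N.-1] lies outside the index type; both sides are false there, the right one because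
     [k.*2 <= N]. *)
  apply/eqP; transitivity false.
    apply/negbTE/negP => /descent_size; rewrite size_tuple; lia.
  have := ltn_ord i; lia.
apply/setP => j; rewrite !inE.
have lt : j < N by have := ltn_ord j; lia.
by have /eqP := h (Ordinal lt).
Qed.

(** The only ballot word with these descents is an [odd_word], with [k'] second-row letters; this
    isolates one coefficient of the expansion. *)
Lemma card_ballots_odds (k k' : nat) : k' <= N./2 ->
  #|[set t in ballots k | descents t == odds N k']| = (k == k').
Proof.
move=> hk'.
have sz : size (odd_word k' (N - k'.*2)) == N by rewrite size_odd_word; lia.
have -> : [set t in ballots k | descents t == odds N k'] =
    if k == k' then [set Tuple sz] else set0; last by case: eqP; rewrite ?cards1 ?cards0.
apply/setP => t; rewrite !inE descents_odds //.
transitivity ((k == k') && (t == Tuple sz)); last by case: eqP; rewrite !inE.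
apply/idP/andP => [/andP[/andP[bt /eqP <-] /forallP d]|[/eqP -> /eqP ->]]; last first.
  rewrite /= ballot_odd_word count_odd_word eqxx /=; apply/forallP => i.
  by rewrite /= descent_odd_word.
have e : val t = odd_word k' (N - k'.*2).
  rewrite -[in RHS](size_tuple t); apply: odd_wordP => // i.
  have [lt|ge] := ltnP i N; first by have /eqP := d (Ordinal lt).
  transitivity false; last lia.
  apply/negbTE/negP => /descent_size; rewrite size_tuple; lia.
by split; [rewrite e count_odd_word | apply/eqP/val_inj].
Qed.

(** Makes the sets [odds N k] representatives of all the sizes that sparse sets can have. *)
Lemma card_odds (k : nat) : k <= N./2 -> #|odds N k| = k.
Proof.
move=> hk; have lt (i : 'I_k) : i.*2 < N.-1 by have := ltn_ord i; lia.
have inj : injective (fun i => Ordinal (lt i)).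
  by move=> i i' [/double_inj e]; apply: val_inj.
rewrite -[RHS]card_ord -(card_imset _ inj); congr #|pred_of_set _|.
apply/setP => j; rewrite inE; apply/idP/imsetP => [/andP[oj ltj]|[i _ ->]] /=; last first.
  by rewrite odd_double /=; have := ltn_ord i; lia.
have lt' : j./2 < k by lia.
by exists (Ordinal lt') => //; apply: val_inj; rewrite /=; move: oj => /=; lia.
Qed.
End Sets.

(** * Functions on sets determined by their sums *)

Lemma card_fibers (T I : finType) (S : {set T}) (D : T -> I) (P : pred I) :
  #|[set a in S | P (D a)]| = \sum_(K | P K) #|[set a in S | D a == K]|.
Proof.
rewrite -sum1_card (partition_big D P) => [|a]; last by rewrite inE => /andP[].
apply: eq_bigr => K PK; rewrite -sum1_card; apply: eq_bigl => a.
by rewrite !inE -andbA; case: eqP => [->|]; rewrite ?andbF // PK.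
Qed.

Local Open Scope ring_scope.

(** By induction on [#|J|], all terms of the sum over the subsets of [J] but that of [J] itself
    already vanish. *)
Lemma subset_sum_eq0 (T : finType) (V : zmodType) (F : {set T} -> V) :
  (forall J : {set T}, \sum_(K : {set T} | K \subset J) F K = 0) -> forall J, F J = 0.
Proof.
move=> F0 J; have [n] := ubnP #|J|; elim: n J => // n IH J ltn.
have := F0 J; rewrite (bigD1 J) //= big1 ?addr0 // => K /andP[KJ ne].
have ltc : (#|K| < #|J|)%N by apply: proper_card; rewrite properEneq ne.
by apply: IH; lia.
Qed.

Lemma sparse_sum_eq0 (N : nat) (V : zmodType) (F : {set 'I_N.-1} -> V) :
  (forall J, ~~ sparse J -> F J = 0) ->
  (forall J J' : {set 'I_N.-1}, sparse J -> sparse J' -> #|J| = #|J'| ->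
    \sum_(K : {set 'I_N.-1} | J \subset K) F K =
    \sum_(K : {set 'I_N.-1} | J' \subset K) F K) ->
  (forall k, (k <= N./2)%N -> F (odds N k) = 0) ->
  forall J, F J = 0.
Proof.
move=> Fns Fsup Fodds J.
have [n] := ubnP (N./2 - #|J|)%N; elim: n J => // n IH J ltn.
have [spJ|/Fns //] := boolP (sparse J).
(* A proper superset is either not sparse or covered by the induction, so only the term of [K]
   remains. *)
have top (K : {set 'I_N.-1}) : #|K| = #|J| -> sparse K ->
    \sum_(L : {set 'I_N.-1} | K \subset L) F L = F K.
  move=> eK _; rewrite (bigD1 K) //= big1 ?addr0 // => L /andP[KL ne].
  have [spL|/Fns //] := boolP (sparse L).
  have ltc : (#|K| < #|L|)%N by apply: proper_card; rewrite properEneq eq_sym ne.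
  have := card_sparse spL => leL; apply: IH; lia.
have le := card_sparse spJ.
have co := card_odds le.
rewrite -(top J) // (Fsup J (odds N #|J|)) ?co ?sparse_odds //.
by rewrite top ?sparse_odds // Fodds.
Qed.

(** * Sparse subsets of a set of positions *)

(** Adding or removing a fixed [x] in [X] pairs off terms of opposite sign. *)
Lemma sum_subset_sign (T : finType) (X : {set T}) :
  \sum_(J : {set T} | J \subset X) (-1) ^+ #|J| = (X == set0)%:R :> int.
Proof.
have [->|/set0Pn[x xX]] := eqVneq X set0.
  by rewrite (big_pred1 set0) ?cards0 // => J; rewrite /= subset0.
rewrite (bigID [pred J : {set T} | x \in J]) /=.
rewrite (reindex_onto (fun J => x |: J) (fun J => J :\ x)) /=; last first.
  by move=> J /andP[_ xJ]; rewrite setD1K.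
rewrite -[X in X + _]opprK; apply/eqP; rewrite addrC subr_eq0; apply/eqP.
rewrite -sumrN; apply: eq_big => [J|J /andP[_ xJ]].
  rewrite subUset sub1set xX setU11 andbT /=; congr (_ && _).
  by apply/idP/eqP => [xJ|<-]; [rewrite setU1K | rewrite setD11].
by rewrite cardsU1 xJ exprD expr1 mulN1r opprK.
Qed.

Lemma natr_card (A : finType) (R : pzSemiRingType) (P : pred A) :
  #|[set a | P a]|%:R = \sum_a (P a)%:R :> R.
Proof.
rewrite -sum1_card natr_sum big_mkcond; apply: eq_bigr => a _.
by rewrite inE; case: (P a).
Qed.

(** Inclusion-exclusion: for fixed [a], the signed sum over the [J] contained in both [X] and [D a]
    detects whether these are disjoint. *)
Lemma card_disjoint_sum (T A : finType) (D : A -> {set T}) (X : {set T}) :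
  #|[set a | D a \subset ~: X]|%:R =
  \sum_(J : {set T} | J \subset X) (-1) ^+ #|J| * #|[set a | J \subset D a]|%:R :> int.
Proof.
under [RHS]eq_bigr => J _ do rewrite natr_card mulr_sumr.
rewrite exchange_big /= natr_card; apply: eq_bigr => a _.
rewrite -disjoints_subset disjoint_sym -setI_eq0 -sum_subset_sign.
rewrite [RHS](bigID (fun J : {set T} => J \subset D a)) /=.
rewrite [X in _ + X]big1 ?addr0 => [|J /andP[_ /negbTE->]]; last by rewrite mulr0.
apply: eq_big => [J|J]; first by rewrite subsetI.
by rewrite subsetI => /andP[_ ->]; rewrite mulr1.
Qed.

(** [e] marks the allowed positions, [t] the chosen ones, and [b] tells whether the position just
    before was chosen. *)
Fixpoint sparse_within (b : bool) (e t : seq bool) : bool :=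
  match e, t with
  | [::], [::] => true
  | c :: e', x :: t' => (x ==> c && ~~ b) && sparse_within x e' t'
  | _, _ => false
  end.

Lemma sparse_withinP (b : bool) (e t : seq bool) : size e = size t ->
  reflect ((forall i, nth false t i -> nth false e i) /\ sparse_mask (b :: t))
          (sparse_within b e t).
Proof.
elim: e t b => [|c e IH] [|x t] b //= => [_|[sz]].
  by apply: ReflectT; split=> [i|[|i]] /=; rewrite ?nth_nil.
apply: (iffP andP) => [[/implyP xcb /(IH _ _ sz) [sub sp]]|[sub sp]].
  split=> [[|i] //= |]; first by move/xcb => /andP[].
    exact: sub.
  by case=> [|i] /=; [case: x xcb {sp} => [/(_ isT)/andP[_ /negbTE->]|] | apply: sp].
split; last by apply/(IH _ _ sz); split=> i; [apply: (sub i.+1) | apply: (sp i.+1)].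
apply/implyP => xt; apply/andP; split; first by apply: (sub 0%N).
apply/negP => bt; by have := sp 0%N bt; rewrite /= xt.
Qed.

(** Transfer recursion for the generating polynomial, by size, of the choices allowed by
    [sparse_within b e]. *)
Fixpoint sparse_poly (b : bool) (e : seq bool) : {poly int} :=
  if e is c :: e' then
    sparse_poly false e' + (if c && ~~ b then 'X * sparse_poly true e' else 0)
  else 1.

Lemma sparse_polyE (n : nat) (b : bool) (e : seq bool) : size e = n ->
  \sum_(t : n.-tuple bool | sparse_within b e t) 'X^(count id t) = sparse_poly b e.
Proof.
elim: n b e => [|n IH] b [|c e] //= => [_|[sz]].
  rewrite big_mkcond (big_pred1 [tuple]) //= => t.
  by apply/esym/eqP; rewrite tuple0.
rewrite big_mkcond (sum_tupleS n (fun t => if sparse_within b (c :: e) t then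
  'X^(count id t) else 0 : {poly int})) /= -big_mkcond IH //; congr (_ + _).
case: ifP => _; last by rewrite big1.
by rewrite -big_mkcond -IH // mulr_sumr; apply: eq_bigr => t _; rewrite exprS.
Qed.

(** A forbidden position separates two parts in which the choices are independent. *)
Lemma sparse_poly_cat (b : bool) (e e' : seq bool) :
  sparse_poly b (e ++ false :: e') = sparse_poly b e * sparse_poly false e'.
Proof.
elim: e b => [|c e IH] b /=; first by rewrite addr0 mul1r.
by rewrite !IH mulrDl; case: ifP; rewrite ?mul0r // mulrA.
Qed.

(** The final [false] closes the last run, so that in a weakly increasing word every run of [l.+1]
    equal letters reads [l] times [true], then [false]. *)
Fixpoint eq_mask (w : seq nat) : seq bool :=
  if w is x :: w' then (if w' is y :: _ then x == y else false) :: eq_mask w'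
  else [::].

Lemma size_eq_mask (w : seq nat) : size (eq_mask w) = size w.
Proof. by elim: w => //= x w ->. Qed.

Lemma nth_eq_mask (w : seq nat) (i : nat) :
  nth false (eq_mask w) i = (i.+1 < size w)%N && (nth 0%N w i == nth 0%N w i.+1).
Proof. by elim: w i => [|x [|y w] IH] [|i] //=; rewrite ?nth_nil // IH. Qed.

Lemma eq_mask_cat (x l : nat) (w : seq nat) : x \notin w ->
  eq_mask (nseq l.+1 x ++ w) = nseq l true ++ false :: eq_mask w.
Proof.
move=> xw; elim: l => [|l /= ->]; last by rewrite eqxx.
by case: w xw => [|y w] //=; rewrite inE negb_or => /andP[/negbTE-> _].
Qed.

Lemma sorted_nseq_cat (x : nat) (w : seq nat) : sorted leq (x :: w) ->
  w = nseq (count_mem x w) x ++ [seq y <- w | y != x].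
Proof.
elim: w => [|y w IH] //= /andP[xy pw].
have [e|ne] := eqVneq y x; first by subst y; rewrite /= -IH.
have nx : x \notin w.
  by apply/negP => /(sorted_cons_all (pw : sorted leq (y :: w))); lia.
rewrite (count_memPn nx) /=; congr (_ :: _); apply/esym/all_filterP/allP => z zw.
by apply/eqP => e; move: nx; rewrite -e zw.
Qed.

(** The runs are separated by forbidden positions, and each contributes a factor which depends only
    on its length. *)
Lemma sparse_poly_eq_mask (w : seq nat) : sorted leq w ->
  sparse_poly false (eq_mask w) =
  \prod_(x <- undup w) sparse_poly false (nseq (count_mem x w).-1 true).
Proof.
have [n] := ubnP (size w); elim: n w => // n IH [|x w] ltn srt; first by rewrite big_nil.
have e := sorted_nseq_cat srt; set u := [seq y <- w | y != x] in e.
have xu : x \notin u by rewrite mem_filter eqxx.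
have su : sorted leq u by apply: sorted_filter (sorted_behead srt); exact: leq_trans.
have xw : x :: w = nseq (count_mem x w).+1 x ++ u by rewrite [in LHS]e.
rewrite xw eq_mask_cat // sparse_poly_cat IH //; last first.
  rewrite size_filter; apply: leq_ltn_trans (count_size _ _) _; exact: ltn.
have p : perm_eq (undup (x :: w)) (x :: undup u).
  apply: uniq_perm => [||y]; first exact: undup_uniq.
    by rewrite /= mem_undup xu undup_uniq.
  by rewrite mem_undup !inE mem_undup mem_filter; case: eqVneq.
rewrite -xw (perm_big _ p) big_cons /= eqxx /=; congr (_ * _).
apply: eq_big_seq => y; rewrite mem_undup mem_filter => /andP[yx _].
by rewrite count_filter eq_sym (negbTE yx) add0n; congr (sparse_poly _ (nseq _.-1 _));
  apply: eq_count => z /=; case: eqVneq => // ->.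
Qed.

(** Renaming the letters preserves the lengths of the runs, hence only permutes the factors. *)
Lemma sparse_poly_map (s : nat -> nat) (w w' : seq nat) : injective s ->
  sorted leq w -> sorted leq w' -> perm_eq w' (map s w) ->
  sparse_poly false (eq_mask w') = sparse_poly false (eq_mask w).
Proof.
move=> inj sw sw' p; rewrite !sparse_poly_eq_mask //.
have pu : perm_eq (undup w') (map s (undup w)).
  rewrite -undup_map_inj //; apply: uniq_perm; rewrite ?undup_uniq // => x.
  by rewrite !mem_undup (perm_mem p).
rewrite (perm_big _ pu) big_map; apply: eq_bigr => x _.
by rewrite (permP p) count_map; congr (sparse_poly _ (nseq _.-1 _));
  apply: eq_count => y /=; rewrite inj_eq.
Qed.

Definition ascents (N : nat) (w : seq nat) : {set 'I_N.-1} :=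
  [set j : 'I_N.-1 | (nth 0%N w j < nth 0%N w j.+1)%N].

Lemma mask_of_ascentsC (N : nat) (w : seq nat) : size w = N -> sorted leq w ->
  mask_of (~: ascents N w) = eq_mask w.
Proof.
move=> sz srt; apply: (@eq_from_nth _ false); first by rewrite size_mkseq size_eq_mask.
move=> i _; rewrite nth_mask_of nth_eq_mask sz.
have [lt|ge] := ltnP i.+1 N; last first.
  by apply/negbTE/negP => /mapP[j _ /= e]; have := ltn_ord j; lia.
have lt' : (i < N.-1)%N by lia.
rewrite (mem_mask_of (~: ascents N w) (Ordinal lt')) !inE /= -leqNgt.
have := sorted_leq_nth leq_trans leqnn 0%N srt.
move=> /(_ i i.+1); rewrite !inE sz => /(_ (ltnW lt) lt (leqnSn _)).
by rewrite eqn_leq => ->.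
Qed.

Lemma sum_sparse_subset (N : nat) (E : {set 'I_N.-1}) :
  \sum_(J : {set 'I_N.-1} | sparse J && (J \subset E)) 'X^#|J| =
  sparse_poly false (mask_of E).
Proof.
have szE : size (mask_of E) = N by rewrite size_mkseq.
rewrite -(sparse_polyE _ szE).
have szm (J : {set 'I_N.-1}) : size (mask_of J) == N by rewrite size_mkseq.
rewrite (reindex_onto (fun J => Tuple (szm J))
  (fun t : N.-tuple bool => [set j : 'I_N.-1 | nth false t j])) /=.
  apply: eq_big => [J|J _]; last by rewrite count_mask_of.
  have -> : [set j : 'I_N.-1 | nth false (mask_of J) j] == J.
    by apply/eqP/setP => j; rewrite inE nth_mask_of mem_mask_of.
  have szJ : size (mask_of E) = size (mask_of J) by rewrite !size_mkseq.
  rewrite andbT; apply/andP/(sparse_withinP _ szJ) => [[/sparseP sp /subsetP sub]|[sub sp]].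
  - split=> [i|[|i]] //; last exact: sp.
    rewrite !nth_mask_of => /mapP[j]; rewrite mem_enum => /sub jE ->.
    by rewrite mem_mask_of.
  - split; first by apply/sparseP => i; apply: (sp i.+1).
    apply/subsetP => j jJ.
    by have := sub j; rewrite !nth_mask_of !mem_mask_of => /(_ jJ).
(* The last letter of [t] is [false], being forbidden by [mask_of E], so [t] comes from a set. *)
move=> t /sparse_withinP; rewrite szE size_tuple => /(_ erefl)[sub _].
apply: val_inj; apply: (@eq_from_nth _ false); rewrite ?size_mkseq ?size_tuple //= => i lt.
rewrite nth_mask_of; apply/mapP/idP => [[j]|ti]; first by rewrite mem_enum inE => tj ->.
have := sub i ti; rewrite nth_mask_of => /mapP[j _ e].
by exists j; rewrite // mem_enum inE -[nat_of_ord j]e.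
Qed.

(** The right-hand side sees [E] only through a polynomial, which is what the symmetry argument
    needs. *)
Lemma sum_subset_coef (N : nat) (A : finType) (D : A -> {set 'I_N.-1})
    (E : {set 'I_N.-1}) :
  (forall a, sparse (D a)) ->
  (forall J J' : {set 'I_N.-1}, sparse J -> sparse J' -> #|J| = #|J'| ->
     #|[set a | J \subset D a]| = #|[set a | J' \subset D a]|) ->
  #|[set a | D a \subset ~: E]|%:R =
  \sum_(j < N.+1) (-1) ^+ j * #|[set a | odds N j \subset D a]|%:R *
    (sparse_poly false (mask_of E))`_j :> int.
Proof.
move=> Dsp Dcard; rewrite card_disjoint_sum -sum_sparse_subset.
transitivity (\sum_(J : {set 'I_N.-1} | sparse J && (J \subset E))
    (-1) ^+ #|J| * #|[set a | odds N #|J| \subset D a]|%:R : int).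
  rewrite (bigID (@sparse N)) /= [X in _ + X]big1 ?addr0 => [|J /andP[_ ns]]; last first.
    (* Subsets of sparse sets are sparse, so no [D a] contains a [J] that is not sparse. *)
    rewrite (_ : [set a | _] = set0) ?cards0 ?mulr0 //.
    apply/setP => a; rewrite !inE; apply: contraNF ns => /subsetP sub.
    have /forallP sp := Dsp a; apply/forallP => i; apply/forallP => j.
    apply/implyP => ij; have /forallP/(_ j)/implyP/(_ ij) := sp i.
    by apply: contra => /andP[/sub -> /sub ->].
  apply: eq_big => [J|J /andP[_ sp]]; first by rewrite andbC.
  by rewrite (Dcard J (odds N #|J|)) ?sparse_odds // card_odds // card_sparse.
under [RHS]eq_bigr => j _ do rewrite coef_sum mulr_sumr.
rewrite exchange_big; apply: eq_bigr => J /andP[sp _].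
have lt : (#|J| < N.+1)%N by have := card_sparse sp; lia.
rewrite (bigD1 (Ordinal lt)) //= coefXn eqxx mulr1 big1 ?addr0 // => j ne.
by rewrite coefXn (_ : _ == _ = false) ?mulr0 //; apply: contraNF ne => /eqP e; apply/eqP/val_inj.
Qed.

(** * Coefficients of the series *)

Lemma gen_seriesE (T : choiceType) (S : classical_sets.set T) (word : T -> seq nat)
    (m : {mset nat}) (r : seq T) : uniq r ->
  (forall t, t \in r <-> S t /\ perm_eq (word t) m) ->
  gen_series S word m = (size r)%:R.
Proof.
have eqm t : (seq_mset (word t) == m) = perm_eq (word t) m.
  by rewrite -[m in LHS]seq_mset_id; apply/eqP/eq_seq_msetP.
move=> ur rP; rewrite /gen_series (fsbigE r) //.
- rewrite -sum1_size natr_sum big_seq_cond [RHS]big_seq.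
  apply: eq_big => [t|t /andP[/rP[_ p] _]]; last by rewrite eqm p.
  by apply: andb_idr => /rP[St _]; exact: mem_set.
- by move=> t /rP[].
- move=> t St; rewrite eqm; case: (boolP (perm_eq _ _)) => // p.
  by have -> : t \in r by apply/rP.
Qed.

Definition sorted_word (m : {mset nat}) : seq nat := sort leq m.

Lemma sorted_sorted_word (m : {mset nat}) : sorted leq (sorted_word m).
Proof. exact: (sort_sorted leq_total). Qed.

Lemma size_sorted_word (m : {mset nat}) : size (sorted_word m) = size m.
Proof. exact: size_sort. Qed.

Lemma perm_sorted_word (w : seq nat) (m : {mset nat}) :
  perm_eq w (sorted_word m) = perm_eq w m.
Proof. by rewrite (permPr (permEl (perm_sort _ _))). Qed.

Lemma sorted_word_eq (w : seq nat) (m : {mset nat}) : sorted leq w ->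
  perm_eq w m -> w = sorted_word m.
Proof.
move=> sw; rewrite -perm_sorted_word => p.
exact: (sorted_eq leq_trans anti_leq sw (sorted_sorted_word m) p).
Qed.

(** Only one weakly increasing word has content [m], namely [sorted_word m]. *)
Lemma fundamental_coef (N : nat) (J : {set 'I_N.-1}) (m : {mset nat}) :
  fundamental_qs J m = ((size m == N) && (J \subset ascents N (sorted_word m)))%:R.
Proof.
have sub (w : seq nat) : (forall j, j \in J -> (nth 0%N w j < nth 0%N w j.+1)%N) <->
    J \subset ascents N w.
  split=> [h|/subsetP h j /h]; last by rewrite inE.
  by apply/subsetP => j jJ; rewrite inE h.
have [sz|sz] := eqVneq (size m) N; last first.
  rewrite /fundamental_qs (gen_seriesE (r := [::])) // => t; split=> // -[_ /perm_size].
  by rewrite size_tuple => e; rewrite e eqxx in sz.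
have szw : size (sorted_word m) == N by rewrite size_sorted_word sz.
have [le|nle] /= := boolP (J \subset _).
  rewrite /fundamental_qs (gen_seriesE (r := [:: Tuple szw])) // => t.
  rewrite inE; split=> [/eqP -> /=|[[st _] p]].
    split; first by split; [exact: sorted_sorted_word | apply/sub].
    by rewrite -perm_sorted_word.
  by apply/eqP/val_inj/sorted_word_eq.
rewrite /fundamental_qs (gen_seriesE (r := [::])) // => t; split=> // -[[st /sub]] + p.
by rewrite [val t](sorted_word_eq st p) (negbTE nle).
Qed.

Lemma Qseries_coef (N : nat) (A : finType) (D : A -> {set 'I_N.-1}) (m : {mset nat}) :
  Qseries D m =
  (if size m == N then #|[set a | D a \subset ascents N (sorted_word m)]| else 0%N)%:R.
Proof.
rewrite /Qseries fct_sumE.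
under eq_bigr => a _ do rewrite fundamental_coef.
by case: eqP => _; [rewrite natr_card | rewrite big1].
Qed.

(** * Two-row Schur functions in terms of ballot words *)

Lemma compat_descents (N : nat) (t : N.-tuple bool) (w : seq nat) :
  compat t w <-> descents t \subset ascents N w.
Proof.
split=> [c|/subsetP sub i d]; first by apply/subsetP => j; rewrite !inE => /c.
have lt : (i < N.-1)%N by have := descent_size d; rewrite size_tuple; lia.
by have := sub (Ordinal lt); rewrite !inE => /(_ d).
Qed.

(** Empty rows are dropped, in step with the zero parts dropped by [two_row]. *)
Definition two_rows (r1 r2 : seq nat) : seq (seq nat) :=
  [seq r <- [:: r1; r2] | (0 < size r)%N].

Lemma flatten_two_rows (r1 r2 : seq nat) : flatten (two_rows r1 r2) = r1 ++ r2.
Proof. by case: r1 r2 => [|? ?] [|? ?] //=; rewrite ?cats0. Qed.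

Lemma shape_two_rows (N k : nat) (r1 r2 : seq nat) :
  size r1 = (N - k)%N -> size r2 = k -> shape (two_rows r1 r2) = two_row N k.
Proof.
by move=> s1 s2; rewrite /two_row -s1 -s2; case: r1 r2 {s1 s2} => [|? ?] [|? ?].
Qed.

Lemma ssyt_two_rows (N k : nat) (t : seq (seq nat)) : (0 < N)%N -> (k <= N./2)%N ->
  ssyt (two_row N k) t <->
  exists r1 r2, [/\ t = two_rows r1 r2, size r1 = (N - k)%N, size r2 = k,
    sorted leq r1 /\ sorted leq r2 & column_strict r1 r2].
Proof.
move=> N0 hk; have Nk : (0 < N - k)%N by lia.
split=> [[sh al col]|[r1 [r2 [-> s1 s2 [o1 o2] col]]]].
  move: sh al col; rewrite /two_row /= Nk; case: (posnP k) => [k0|k0].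
    case: t => [|r1 [|]] //= -[s1] /andP[o1 _] _; exists r1, [::].
    by rewrite /two_rows /= s1 Nk k0.
  case: t => [|r1 [|r2 [|]]] //= -[s1 s2] /and3P[o1 o2 _] col; exists r1, r2.
  by rewrite /two_rows /= s1 s2 Nk k0; split=> // c lt; apply: (col 0%N c); rewrite /= -s2.
split; first exact: shape_two_rows.
  by rewrite all_filter /= o1 o2 !implybT.
move=> [|r] c; rewrite /two_row /two_rows /= s1 s2 Nk; case: (posnP k) => k0 //=.
  by move=> lt; apply: col; rewrite s2.
all: by rewrite nth_nil.
Qed.

Definition tableau_of (w : seq nat) (b : seq bool) : seq (seq nat) :=
  two_rows (mask (map negb b) w) (mask b w).

Lemma schur_coef (N k : nat) (m : {mset nat}) : (0 < N)%N -> (k <= N./2)%N ->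
  schur (two_row N k) m =
  (if size m == N then
     #|[set t in ballots N k | descents t \subset ascents N (sorted_word m)]|
   else 0%N)%:R.
Proof.
move=> N0 hk; have Nk : (0 < N - k)%N by lia.
have [sz|sz] := eqVneq (size m) N; last first.
  rewrite /schur (gen_seriesE (r := [::])) // => t; split=> //.
  move=> -[/(ssyt_two_rows _ N0 hk)[r1 [r2 [-> s1 s2 _ _]]] /perm_size].
  by rewrite flatten_two_rows size_cat s1 s2 => e; move: sz; rewrite -e; lia.
set w := sorted_word m.
have szw : size w = N by rewrite size_sorted_word.
have srt : sorted leq w := sorted_sorted_word m.
set B := [set t in ballots N k | _].
have size1 (b : N.-tuple bool) : count id b = k -> size (mask (map negb b) w) = (N - k)%N.
  move=> cb; rewrite size_mask ?size_map ?size_tuple // count_map.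
  have := count_predC id b; rewrite cb size_tuple => e.
  by rewrite -[in RHS]e addKn; apply: eq_count.
have size2 (b : N.-tuple bool) : count id b = k -> size (mask b w) = k.
  by move=> cb; rewrite size_mask ?size_tuple.
have colP (b : N.-tuple bool) : count id b = k -> compat b w ->
    ballot 0 b <-> column_strict (mask (map negb b) w) (mask b w).
  (* No entry waits at the start, and the second row is not longer than the first since
     [k <= N./2]. *)
  move=> cb c; apply: (@ballot_column_strict b w [::]) => //.
    by rewrite size_tuple.
  by rewrite /= size1 // size2 //; lia.
rewrite /schur (gen_seriesE (r := [seq tableau_of w (val b) | b <- enum B])).
- by rewrite size_map -cardE.
- rewrite map_inj_in_uniq ?enum_uniq // => b b'; rewrite !mem_enum !inE.
  move=> /andP[/andP[_ /eqP cb] /compat_descents c].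
  move=> /andP[/andP[_ /eqP cb'] /compat_descents c'] e.
  have two_rows_inj r1 r2 r1' r2' : (0 < size r1)%N -> (0 < size r1')%N ->
      two_rows r1 r2 = two_rows r1' r2' -> r1 = r1' /\ r2 = r2'.
    by rewrite /two_rows /= => -> ->; case: r2 r2' => [|? ?] [|? ?] //= [] -> // -> ->.
  have [||e1 e2] := two_rows_inj _ _ _ _ _ _ e; rewrite ?size1 //.
  by apply/val_inj/(mask_inj (w := w)); rewrite ?size_tuple.
move=> t; split=> [/mapP[b]|].
  rewrite mem_enum !inE => /andP[/andP[bb /eqP cb] /compat_descents c] ->.
  split; last by rewrite flatten_two_rows -perm_sorted_word perm_mask_negb ?size_tuple.
  apply/(ssyt_two_rows _ N0 hk); exists (mask (map negb b) w), (mask b w).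
  by split; rewrite ?size1 ?size2 //; [split; apply: sorted_mask => //; exact: leq_trans | apply/colP].
move=> [/(ssyt_two_rows _ N0 hk)[r1 [r2 [-> s1 s2 [o1 o2] col]]]].
rewrite flatten_two_rows -perm_sorted_word => p.
(* Surjectivity: the preimage of a tableau is the mask recovered from its two rows. *)
have [b [sb e2 e1 c]] := exists_mask srt o1 o2 p.
have szb : size b == N by rewrite sb szw.
apply/mapP; exists (Tuple szb); last by rewrite /tableau_of /= e1 e2.
have cb : count id b = k by rewrite -s2 -e2 size_mask.
rewrite mem_enum !inE /= cb eqxx andbT; apply/andP; split.
  by apply/(colP (Tuple szb)) => //=; rewrite e1 e2.
by apply/compat_descents.
Qed.

Lemma exists_ascents (N : nat) (J : {set 'I_N.-1}) :
  exists m : {mset nat}, size m = N /\ ascents N (sorted_word m) = J.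
Proof.
(* The number of elements of [J] below [i] rises exactly at the elements of [J]. *)
pose h i := #|[set j in J | (j < i)%N]|; pose w := mkseq h N.
have hS i : (h i <= h i.+1)%N.
  apply: subset_leq_card; apply/subsetP => j; rewrite !inE => /andP[-> lt] /=; lia.
have sw : sorted leq w.
  have hm : {homo h : i j / (i <= j)%N} := homo_leq leqnn (@leq_trans) hS.
  exact: homo_sorted hm _ (iota_sorted 0 N).
have p : perm_eq (seq_mset w) w by exact: perm_eq_seq_mset.
exists (seq_mset w); split; first by rewrite (perm_size p) size_mkseq.
rewrite -(sorted_word_eq sw); last by rewrite perm_sym.
apply/setP => j; have ltj := ltn_ord j; rewrite inE !nth_mkseq; try lia.
rewrite {2}/h (cardsD1 j) inE ltnSn andbT.
have -> : [set i in J | (i < j.+1)%N] :\ j = [set i in J | (i < j)%N].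
  apply/setP => i; rewrite !inE -val_eqE /=; case: (i \in J); rewrite ?andbF //=; lia.
by rewrite -/(h j); case: (j \in J); rewrite ?ltnn ?ltnSn.
Qed.

Lemma fct_mulrzE (T : Type) (V : zmodType) (f : T -> V) (z : int) (x : T) :
  (f *~ z) x = f x *~ z.
Proof.
have E n : (f *+ n) x = f x *+ n.
  by elim: n => [|n IH]; rewrite ?mulr0n // !mulrS -IH.
by case: z => n; [exact: E | exact: (congr1 -%R (E n.+1))].
Qed.

Lemma symmetric_Qseries (N : nat) (A : finType) (D : A -> {set 'I_N.-1}) :
  (forall a, sparse (D a)) ->
  (forall J J' : {set 'I_N.-1}, sparse J -> sparse J' -> #|J| = #|J'| ->
     #|[set a | J \subset D a]| = #|[set a | J' \subset D a]|) ->
  symmetric_function (Qseries D).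
Proof.
move=> Dsp Dcard; split=> [|s m m' [s' sK s'K] mm'].
  by exists N => m lt; rewrite Qseries_coef gtn_eqF.
have p : perm_eq m' (map s m).
  have countE (m0 : {mset nat}) x : count_mem x m0 = m0 x.
    by rewrite -mset_seqE seq_mset_id.
  apply/allP => y _ /=; rewrite count_map countE -[y]s'K mm' -countE.
  by apply/eqP/eq_count => x /=; rewrite (can_eq sK).
have szm : size m' = size m by rewrite (perm_size p) size_map.
rewrite !Qseries_coef szm; have [sz|//] := eqVneq (size m) N.
(* The complement of the strict ascents consists of the equalities between neighbours, whose
   polynomial is invariant under renaming. *)
rewrite -[ascents N (sorted_word m)]setCK -[ascents N (sorted_word m')]setCK.
rewrite !sum_subset_coef //; apply: eq_bigr => j _; congr (_ * _`_j).
rewrite !mask_of_ascentsC ?size_sorted_word ?sorted_sorted_word ?szm //.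
congr polyseq; apply: (sparse_poly_map (can_inj sK)); rewrite ?sorted_sorted_word //.
rewrite (permPl (permEl (perm_sort _ _))) (permPl p) perm_map //.
by rewrite perm_sym (permPl (permEl (perm_sort _ _))).
Qed.

(** * The expansion *)

Section Expansion.
Variables (N : nat) (A : finType) (D : A -> {set 'I_N.-1}).
Implicit Types (c : nat -> int) (J : {set 'I_N.-1}).

(* The coefficient of the fundamental function of [J] in the difference of the
   two sides of the expansion. *)
Definition defect c J : int :=
  #|[set a | D a == J]|%:R -
  \sum_(0 <= k < N./2.+1) #|[set t in ballots N k | descents t == J]|%:R *~ c k.

(** Used with [P] for being contained in an ascent set, containing a given set, and not being
    sparse. *)
Lemma sum_defect c (P : pred {set 'I_N.-1}) :
  \sum_(J | P J) defect c J = #|[set a | P (D a)]|%:R -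
    \sum_(0 <= k < N./2.+1) #|[set t in ballots N k | P (descents t)]|%:R *~ c k.
Proof.
rewrite sumrB; congr (_ - _).
  have -> : [set a | P (D a)] = [set a in setT | P (D a)] by apply/setP => a; rewrite !inE.
  rewrite (card_fibers _ D P) natr_sum; apply: eq_bigr => J _; congr _%:R.
  by apply: eq_card => a; rewrite !inE.
rewrite exchange_big; apply: eq_bigr => k _.
by rewrite card_fibers natr_sum mulrz_suml.
Qed.

(** The difference of the coefficients at a monomial of degree [N] sums the defects over the subsets
    of its ascent set, and every set is such an ascent set. *)
Lemma Qseries_expansionP c : (0 < N)%N ->
  Qseries D = \sum_(0 <= k < N./2.+1) schur (two_row N k) *~ c k <->
  forall J, defect c J = 0.
Proof.
move=> N_gt0; have coefE (m : {mset nat}) : size m = N ->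
    Qseries D m - (\sum_(0 <= k < N./2.+1) schur (two_row N k) *~ c k) m =
    \sum_(J : {set 'I_N.-1} | J \subset ascents N (sorted_word m)) defect c J.
  move=> sz; rewrite sum_defect Qseries_coef sz eqxx fct_sumE; congr (_ - _).
  apply: eq_big_nat => k /andP[_ lt].
  by rewrite fct_mulrzE schur_coef // sz eqxx.
split=> [e|d0].
  apply: subset_sum_eq0 => J; have [m [sz <-]] := exists_ascents J.
  by rewrite -coefE // e subrr.
apply/funext => m; have [sz|sz] := eqVneq (size m) N.
  by apply/eqP; rewrite -subr_eq0 coefE // big1.
rewrite Qseries_coef (negbTE sz) fct_sumE big_nat big1 // => k /andP[_ lt].
by rewrite fct_mulrzE schur_coef // (negbTE sz) mul0rz.
Qed.

(** Each count for [D] is the same combination of counts of ballot words, for which both claims are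
    known. *)
Lemma sparse_of_expansion c : (forall J, defect c J = 0) ->
  (forall a, sparse (D a)) /\
  (forall J J' : {set 'I_N.-1}, sparse J -> sparse J' -> #|J| = #|J'| ->
     #|[set a | J \subset D a]| = #|[set a | J' \subset D a]|).
Proof.
move=> d0; have cardE P : #|[set a | P (D a)]|%:R =
    \sum_(0 <= k < N./2.+1) #|[set t in ballots N k | P (descents t)]|%:R *~ c k :> int.
  by apply/eqP; rewrite -subr_eq0 -sum_defect big1.
split=> [a|J J' sp sp' e].
  have := cardE (fun K => ~~ sparse K); rewrite big1 => [/eqP|k _].
    rewrite pnatr_eq0 cards_eq0 => /eqP/setP/(_ a).
    by rewrite !inE => /negbFE.
  rewrite (_ : [set t in _ | _] = set0) ?cards0 ?mul0rz //.
  by apply/setP => t; rewrite !inE sparse_descents andbF.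
apply/eqP; rewrite -(eqr_nat int); apply/eqP.
rewrite (cardE (fun K => J \subset K)) (cardE (fun K => J' \subset K)).
by apply: eq_bigr => k _; rewrite (card_ballots_descents_sparse _ sp sp' e).
Qed.

Lemma expansion_of_sparse :
  (forall a, sparse (D a)) ->
  (forall J J' : {set 'I_N.-1}, sparse J -> sparse J' -> #|J| = #|J'| ->
     #|[set a | J \subset D a]| = #|[set a | J' \subset D a]|) ->
  forall J, defect (fun k => #|[set a | D a == odds N k]|%:R) J = 0.
Proof.
move=> Dsp Dcard; apply: sparse_sum_eq0 => [J ns|J J' sp sp' e|k lek].
- rewrite /defect (_ : [set a | _] = set0) ?cards0 ?big1 ?subr0 // => [k _|].
    rewrite (_ : [set t in _ | _] = set0) ?cards0 ?mul0rz //.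
    apply/setP => t; rewrite !inE; apply/negbTE; rewrite negb_and orbC.
    by apply/orP; left; apply: contraNneq ns => <-; exact: sparse_descents.
  by apply/setP => a; rewrite !inE; apply/negbTE; apply: contraNneq ns => <-.
- rewrite !sum_defect (Dcard J J') //; congr (_ - _).
  by apply: eq_bigr => k _; rewrite (card_ballots_descents_sparse _ sp sp' e).
(* At [odds N k] only the term of index [k] survives, for a single ballot word, and its coefficient
   is the count to be cancelled. *)
rewrite /defect big_mkord; have lt : (k < N./2.+1)%N by [].
rewrite (bigD1 (Ordinal lt)) //= card_ballots_odds // eqxx.
rewrite big1 => [|i ne]; first by rewrite addr0 mulr1n intz subrr.
rewrite card_ballots_odds // (_ : _ == _ = false) ?mul0rz //.
by apply: contraNF ne => /eqP e; apply/eqP/val_inj.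
Qed.

End Expansion.

(** * Two-row expansions as sums over all partitions *)

Lemma two_row_partition (N k : nat) : (k <= N./2)%N -> is_partition N (two_row N k).
Proof.
move=> le; rewrite /is_partition mem_filter /= /two_row /=.
by case: (posnP (N - k)) => h1; case: (posnP k) => h2 //=; rewrite ?andbT; lia.
Qed.

Lemma nth1_two_row (N k : nat) : (0 < N)%N -> (k <= N./2)%N ->
  nth 0%N (two_row N k) 1 = k.
Proof.
move=> N0 le; rewrite /two_row /=.
have -> : (0 < N - k)%N by lia.
by case: (posnP k) => [->|].
Qed.

Lemma sum_partitions_two_row (N : nat) (c : nat -> nat) : (0 < N)%N ->
  exists d : seq nat -> nat,
    \sum_(la \in [set la | is_partition N la]%classic) schur la *+ d la =
    \sum_(0 <= k < N./2.+1) schur (two_row N k) *+ c k.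
Proof.
move=> N0; pose r := [seq two_row N k | k <- index_iota 0 N./2.+1].
(* The index [k] is read off as the second part, which defaults to 0 for the one-row shape; all
   other partitions get coefficient 0. *)
exists (fun la => if la \in r then c (nth 0%N la 1) else 0%N).
have rP la : la \in r -> is_partition N la.
  move=> /mapP[k]; rewrite mem_index_iota => /andP[_ le] ->; exact: two_row_partition.
rewrite (fsbigE r).
- transitivity (\sum_(la <- r) schur la *+ c (nth 0%N la 1)).
    rewrite big_seq_cond [RHS]big_seq; apply: eq_big => [la|la /andP[-> _] //].
    by apply: andb_idr => /rP p; exact: mem_set.
  rewrite big_map big_nat [RHS]big_nat; apply: eq_bigr => k /andP[_ le].
  by rewrite nth1_two_row.
- rewrite map_inj_in_uniq ?iota_uniq // => k k'; rewrite !mem_index_iota => le le' e.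
  by rewrite -(@nth1_two_row N k) // e nth1_two_row.
- by move=> la /rP.
- by move=> la _ /negbTE ->; rewrite mulr0n.
Qed.

Unset Implicit Arguments.

Theorem theorem1p8 (N : nat) (A : finType) (D : A -> {set 'I_N.-1})
    (hN : (0 < N)%N) :
  let n := N./2 in
  let cond_i :=
    (forall a : A, sparse (D a)) /\
    (forall J J' : {set 'I_N.-1}, sparse J -> sparse J' -> #|J| = #|J'| ->
       #|[set a : A | J \subset D a]| = #|[set a : A | J' \subset D a]|) in
  let cond_ii :=
    symmetric_function (Qseries D) /\
    (exists c : nat -> int,
       Qseries D = \sum_(0 <= k < n.+1) schur (two_row N k) *~ c k) in
  (cond_i <-> cond_ii) /\
  (cond_i ->
     schur_positive N (Qseries D) /\
     Qseries D =
       \sum_(0 <= k < n.+1)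
          schur (two_row N k) *+ #|[set a : A | D a == odds N k]|).
Proof.
move=> n cond_i cond_ii.
have expansion : cond_i -> Qseries D = \sum_(0 <= k < n.+1)
    schur (two_row N k) *~ #|[set a : A | D a == odds N k]|%:R.
  by move=> [Dsp Dcard]; apply/(Qseries_expansionP D _ hN)/expansion_of_sparse.
split; first split=> [i|[_ [c /(Qseries_expansionP D _ hN)]]].
- by split; [case: i => *; exact: symmetric_Qseries | eexists; exact: expansion i].
- exact: sparse_of_expansion.
move=> i; have e : Qseries D = \sum_(0 <= k < n.+1)
    schur (two_row N k) *+ #|[set a : A | D a == odds N k]|.
  by rewrite (expansion i); apply: eq_bigr => k _; rewrite natz.
split=> //; split; first by case: i => *; exact: symmetric_Qseries.
have [d ed] := sum_partitions_two_row (fun k => #|[set a | D a == odds N k]|) hN.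
by exists d; rewrite ed.
Qed.
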